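(* Let $\Gamma = \mathbb{Z}^2 \rtimes_{-\mathrm{id}} \mathbb{Z}/2$, where the generator of $\mathbb{Z}/2$ acts on $\mathbb{Z}^2$ by $-\mathrm{id}$. For every finite symmetric generating set $S$ of $\Gamma$, the pair $(\Gamma,S)$ is a Dress--Farrell--Hsiang group of bounded depth with respect to the family of virtually cyclic subgroups of $\Gamma$.
   Context: A $G$-simplicial complex is an (abstract) simplicial complex $X$ with a simplicial $G$-action such that whenever $g \in G$ fixes a simplex $\{x_0,\dots,x_n\}$ of $X$ (as a set), then $g x_i = x_i$ for all $i$. Points and metrics of such a complex refer to its geometric realisation; the $\ell^1$-metric is $d^{\ell^1}(\sum_v \lambda_v v, \sum_v \mu_v v) = \sum_v |\lambda_v - \mu_v|$ in barycentric coordinates. A map from the discrete set $G$ to a complex means a map into its geometric realisation. The class $\mathcal{D}r$ (Dress family) consists of the finite groups $D$ for which there are primes $p$ and $q$ and a normal series $P \unlhd H \unlhd D$ such that $P$ is a finite $p$-group, $H/P$ is a finite cyclic group and $D/H$ is a finite $q$-group. The depth $d(F)$ of a finite group $F$ is the largest $n$ such that there is a chain of subgroups $F_1 \supsetneq F_2 \supsetneq \dots \supsetneq F_n$ in $F$. Let $G$ be a group, $S$ a finite symmetric generating set of $G$ and $\mathcal{F}$ a family of subgroups of $G$ (closed under conjugation and taking subgroups). $(G,S)$ is a Dress--Farrell--Hsiang group of bounded depth with respect to $\mathcal{F}$ if there exist $N \in \mathbb{N}$ and $B \in \mathbb{N}$ such that for every $\epsilon > 0$ there are (i) an epimorphism $\pi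 \colon G \twoheadrightarrow F$ onto a finite group with $d(F) \leq B$, and (ii) for every subgroup $D \leq F$ with $D \in \mathcal{D}r$, a $G$-simplicial complex $E_D$ of dimension at most $N$ whose isotropy groups lie in $\mathcal{F}$, and a $\overline{D} := \pi^{-1}(D)$-equivariant map $f_D \colon G \to E_D$ (where $\overline{D}$ acts on $G$ by left multiplication) such that $d^{\ell^1}(f_D(g),f_D(g')) \leq \epsilon$ whenever $g,g' \in G$ satisfy $g^{-1}g' \in S$. A group is virtually cyclic if it contains a cyclic subgroup of finite index (finite groups included). *)

(* Defs.v *)
From HB Require Import structures.
From mathcomp Require Import all_boot all_order all_algebra all_fingroup.
From mathcomp Require Import all_solvable finmap.
From mathcomp Require Import boolp classical_sets cardinality fsbigop reals.

Set Implicit Arguments.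
Unset Strict Implicit.
Unset Printing Implicit Defensive.

Import Order.TTheory GRing.Theory Num.Theory.

Local Open Scope classical_set_scope.
Local Open Scope group_scope.

Section Subgroups.
Variable G : groupType.
Implicit Types (H K C : set G) (g c x y : G).

Definition is_subgroup H : Prop :=
  [/\ H 1, forall x y, H x -> H y -> H (x * y) & forall x, H x -> H x^-1].

Definition conj_set H g : set G := (fun x => x ^ g) @` H.

Definition cyclic_subgroup c : set G :=
  [set x | exists n : nat, x = c ^+ n \/ x = c ^- n].

Definition left_cosets C H : set (set G) :=
  (fun x => (fun k => x * k) @` C) @` H.

Definition virtually_cyclic H : Prop :=
  exists2 c, H c & finite_set (left_cosets (cyclic_subgroup c) H).

End Subgroups.

Record family (G : groupType) := Family {
  family_mem : set (set G);
  family_subgroup : forall H, family_mem H -> is_subgroup H;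
  family_conj : forall H g, family_mem H -> family_mem (conj_set H g);
  family_sub : forall H K, family_mem H -> is_subgroup K -> K `<=` H ->
    family_mem K
}.

Section VirtuallyCyclicFamily.
Variable G : groupType.
Implicit Types (H K C : set G) (g c x y : G).

Definition vcyc_set : set (set G) :=
  [set H | is_subgroup H /\ virtually_cyclic H].

Fact vcyc_subgroup H : vcyc_set H -> is_subgroup H.
Proof. by case. Qed.

Fact vcyc_conj H g : vcyc_set H -> vcyc_set (conj_set H g).
Proof.
case=> -[H1 HM HV] [c Hc finH]; split.
  split; first by exists 1 => //; rewrite conj1g.
    by move=> _ _ [x Hx <-] [y Hy <-]; exists (x * y); rewrite ?conjMg //;
       apply: HM.
  by move=> _ [x Hx <-]; exists x^-1; rewrite ?conjVg //; apply: HV.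
exists (c ^ g); first by exists c.
apply: (@sub_finite_set _ _
  ((fun E => conj_set E g) @` left_cosets (cyclic_subgroup c) H)); last first.
  exact: finite_image.
move=> _ [_ [x Hx <-] <-].
exists ((fun k => x * k) @` cyclic_subgroup c); first by exists x.
apply/seteqP; split=> y.
  case=> _ [k [n kE] <-] <-; exists (k ^ g); last by rewrite conjMg.
  by exists n; case: kE => ->; rewrite ?conjVg conjXg; [left|right].
case=> k [n kE] <-; exists (x * k ^ g^-1); last by rewrite conjMg conjgKV.
exists (k ^ g^-1) => //; exists n.
by case: kE => ->; [left|right]; rewrite ?conjVg conjXg conjgK.
Qed.

Fact subgroupX K x n : is_subgroup K -> K x -> K (x ^+ n).
Proof.
by case=> K1 KM _ Kx; elim: n => [|n IHn]; rewrite ?expg0 // expgS; apply: KM.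
Qed.

Fact cyclic_subgroupI K c : is_subgroup K ->
  exists2 d, K d & K `&` cyclic_subgroup c = cyclic_subgroup d.
Proof.
move=> sK; have [K1 KM KV] := sK.
pose p n := `[< K (c ^+ n.+1) >].
have [exp|noK] := pselect (exists n, p n); last first.
  exists 1 => //; apply/seteqP; split=> x; last first.
    move=> [n xE]; have ->: x = 1 by case: xE => ->; rewrite expg1n ?invg1.
    by split=> //; exists 0; left; rewrite expg0.
  case=> Kx [[|n] xE]; first by exists 0; case: xE => ->; [left|right].
  case: noK; exists n; apply/asboolP; case: xE => xE; first by rewrite -xE.
  by rewrite -[X in K X]invgK -xE; apply: KV.
have [m /asboolP Km minm] := ex_minnP exp.
have modK n : K (c ^+ n) -> exists q, c ^+ n = (c ^+ m.+1) ^+ q.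
  move=> Kn; exists (n %/ m.+1)%N.
  rewrite -expgM mulnC {1}(divn_eq n m.+1) expgD.
  case rE: (n %% m.+1)%N => [|r]; first by rewrite expg0 mulg1.
  have: K (c ^+ r.+1).
    have Eq : c ^+ n = c ^+ (n %/ m.+1 * m.+1) * c ^+ r.+1.
      by rewrite -expgD -rE -divn_eq.
    rewrite -(mulKg (c ^+ (n %/ m.+1 * m.+1)) (c ^+ r.+1)) -Eq.
    by apply: KM => //; apply: KV; rewrite mulnC expgM; apply: subgroupX.
  move/asboolP/minm => le_mr.
  by have := ltn_pmod n (ltn0Sn m); rewrite rE ltnS ltnNge le_mr.
exists (c ^+ m.+1) => //; apply/seteqP; split=> x.
  case=> Kx [n [xE|xE]].
    by have [|q qE] := modK n; [rewrite -xE | exists q; left; rewrite xE qE].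
  have [|q qE] := modK n; last by exists q; right; rewrite xE qE.
  by rewrite -[X in K X]invgK -xE; apply: KV.
case=> n xE; split.
  by case: xE => ->; [|apply: KV]; apply: subgroupX.
by exists (m.+1 * n)%N; rewrite expgM.
Qed.

Fact vcyc_sub H K : vcyc_set H -> is_subgroup K -> K `<=` H -> vcyc_set K.
Proof.
case=> _ [c Hc finH] sK subKH; split=> //.
have [K1 KM KV] := sK; have [d Kd dE] := cyclic_subgroupI c sK.
exists d => //; rewrite -dE.
apply: (@sub_finite_set _ _
  ((fun E => E `&` K) @` left_cosets (cyclic_subgroup c) H)); last first.
  exact: finite_image.
move=> _ [x Kx <-]; exists ((fun k => x * k) @` cyclic_subgroup c).
  by exists x => //; apply: subKH.
apply/seteqP; split=> y.
  case=> -[k Ck <-] Kxk; exists k => //; split=> //.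
  by rewrite -(mulKg x k); apply: KM => //; apply: KV.
by case=> k [Kk Ck] <-; split; [exists k | apply: KM].
Qed.

Definition vcyc : family G := Family vcyc_subgroup vcyc_conj vcyc_sub.

End VirtuallyCyclicFamily.

Section FiniteGroups.
Variable gT : finGroupType.
Implicit Types (D F : {group gT}) (c : seq {group gT}).

Definition dress D : Prop :=
  exists p q : nat, [/\ prime p, prime q &
  exists P H : {group gT}, [/\ P <| H, H <| D &
    [/\ p.-group P, cyclic (H / P) & q.-group (D / H)]]].

Definition strict_chain F c : bool :=
  all (fun A : {group gT} => A \subset F) c &&
  sorted (fun A B : {group gT} => B \proper A) c.

(* A strict chain has no repetition, so its length is at most the number of
   subgroups; [depth_max] and [depth_attained] show that the truncated maximum
   is the true one. *)
Definition depth F : nat :=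
  \max_(n < #|{group gT}|.+1 | [exists c : n.-tuple {group gT},
                                  strict_chain F c]) n.

Lemma strict_chain_size F c : strict_chain F c -> size c <= #|{group gT}|.
Proof.
case/andP=> _ sc; have uc : uniq c.
  apply: (@sorted_uniq _ (fun A B : {group gT} => B \proper A)) sc.
    by move=> B A C /= BA CB; apply: proper_trans CB BA.
  by move=> A /=; apply/negbTE/negP => /properP[_ [x xA]]; rewrite xA.
by rewrite -(card_uniqP uc) max_card.
Qed.

Lemma depth_max F c : strict_chain F c -> size c <= depth F.
Proof.
move=> sc; have lt_c : size c < #|{group gT}|.+1.
  by rewrite ltnS (strict_chain_size sc).
apply: (@bigop.leq_bigmax_cond _ _ (@nat_of_ord _) (Ordinal lt_c)).
by apply/existsP; exists (in_tuple c).
Qed.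

Lemma depth_attained F : exists2 c, strict_chain F c & size c = depth F.
Proof.
have ex0 : [exists c : (@ord0 #|{group gT}|).-tuple {group gT},
              strict_chain F c] by apply/existsP; exists [tuple].
rewrite /depth (bigop.bigmax_eq_arg ord0) //.
by case: arg_maxnP => // n /existsP[c sc] _; exists c; rewrite ?size_tuple.
Qed.

End FiniteGroups.

Record gcomplex (G : groupType) := GComplex {
  vertex : choiceType;
  simplex : {fset vertex} -> Prop;
  vact : G -> vertex -> vertex;
  simplex_neq0 : forall s, simplex s -> s <> fset0;
  simplex_face : forall s t, simplex s -> (t `<=` s)%fset -> t <> fset0 ->
    simplex t;
  simplex_vertex : forall v, simplex [fset v]%fset;
  vact1 : forall v, vact 1 v = v;
  vactM : forall g h v, vact (g * h) v = vact g (vact h v);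
  simplex_vact : forall g s, simplex s -> simplex (vact g @` s)%fset;
  vact_fix : forall g s, simplex s -> (vact g @` s)%fset = s ->
    forall v, v \in s -> vact g v = v
}.
Arguments simplex {G} _ _.
Arguments vact {G} _ _ _.

Section GComplex.
Variables (R : realType) (G : groupType) (X : gcomplex G).
Local Open Scope ring_scope.
Implicit Types x y : vertex X -> R.

Definition dim_le (N : nat) : Prop :=
  forall s, simplex X s -> (#|` s| <= N.+1)%N.

(* Points are given by their barycentric coordinates. *)
Definition realisation : set (vertex X -> R) :=
  [set x | (forall v, 0 <= x v) /\
     exists s, [/\ simplex X s, forall v, v \notin s -> x v = 0 &
                   \sum_(v <- s) x v = 1]].

Definition pact (g : G) x : vertex X -> R := fun v => x (vact X g^-1%g v).

Definition stabiliser x : set G := [set g | pact g x = x].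

(* The sum over all vertices is a finite one: points have finite support. *)
Definition l1dist x y : R := \sum_(v \in [set: vertex X]) `|x v - y v|.

Lemma realisation_pact g x : realisation x -> realisation (pact g x).
Proof.
move=> [x_ge0 [s [Xs xs0 xs1]]]; split=> [v|]; first exact: x_ge0.
have gK h : cancel (vact X h) (vact X h^-1%g).
  by move=> v; rewrite -vactM mulVg vact1.
exists (vact X g @` s)%fset; split; first exact: simplex_vact.
  move=> v vNgs; apply: xs0; apply: contra vNgs => gvs.
  apply/imfsetP; exists (vact X g^-1%g v) => //.
  by have := gK g^-1%g v; rewrite invgK.
rewrite big_imfset /=; last by move=> u v _ _; apply: can_inj (gK g) _ _.
by rewrite -xs1; apply: eq_bigr => v _; rewrite /pact gK.
Qed.

End GComplex.
Arguments realisation R {G} X.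

Definition is_sym_gen_set (G : groupType) (S : {fset G}) : Prop :=
  (forall s, s \in S -> s^-1 \in S) /\
  (forall H : set G, is_subgroup H -> (forall s, s \in S -> H s) -> H = setT).

Definition DFH_bounded_depth (R : realType) (G : groupType) (S : {fset G})
    (F : family G) : Prop :=
  exists N B : nat, forall eps : R, (0 < eps)%R ->
  exists (Q : finGroupType) (pi : {multiplicative G -> Q}),
    [/\ forall q, exists g, pi g = q,
        depth [set: Q]%G <= B &
    forall D : {group Q}, dress D ->
    exists E : gcomplex G,
      [/\ dim_le E N,
          forall x, realisation R E x -> family_mem F (stabiliser x) &
      exists f : G -> vertex E -> R,
        [/\ forall g, realisation R E (f g),
            forall h g, pi h \in D -> f (h * g) = pact h (f g) &
            forall g g', g^-1 * g' \in S -> (l1dist (f g) (f g') <= eps)%R]]].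

(* The semidirect product of [int * int] and ['Z_2], the nonzero element of
   ['Z_2] acting by [-id]. *)
Definition Gamma : Type := ((int * int) * 'Z_2)%type.

Section Gamma.
Local Open Scope ring_scope.

Definition sign_act (s : 'Z_2) (a : int * int) : int * int :=
  if s == 0 then a else - a.

Definition Gamma_one : Gamma := (0, 0).

Definition Gamma_mul (x y : Gamma) : Gamma :=
  (x.1 + sign_act x.2 y.1, x.2 + y.2).

Definition Gamma_inv (x : Gamma) : Gamma := (- sign_act x.2 x.1, - x.2).

Fact sign_actD s a b : sign_act s (a + b) = sign_act s a + sign_act s b.
Proof. by rewrite /sign_act; case: ifP => // _; rewrite opprD. Qed.

Fact Z2_cases (s : 'Z_2) : s = 0 \/ s = 1.
Proof. by case: s => -[|[|//]] i; [left|right]; apply: val_inj. Qed.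

Fact sign_act_add s t a : sign_act (s + t) a = sign_act s (sign_act t a).
Proof.
by rewrite /sign_act; case: (Z2_cases s) (Z2_cases t) => -> [] ->;
   rewrite //= opprK.
Qed.

Fact Gamma_mulA : associative Gamma_mul.
Proof.
move=> x y z; rewrite /Gamma_mul /=.
by rewrite sign_actD sign_act_add !addrA.
Qed.

Fact Gamma_mul1 : left_id Gamma_one Gamma_mul.
Proof. by case=> a s; rewrite /Gamma_mul /= !add0r. Qed.

Fact Gamma_mulr1 : right_id Gamma_one Gamma_mul.
Proof.
case=> a s; rewrite /Gamma_mul /= /sign_act.
by case: ifP => _; rewrite ?oppr0 !addr0.
Qed.

Fact Gamma_mulV : left_inverse Gamma_one Gamma_inv Gamma_mul.
Proof.
case=> a s; rewrite /Gamma_mul /Gamma_inv /= addNr; congr (_, _).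
by case: (Z2_cases s) => ->; rewrite /sign_act /= addNr.
Qed.

Fact Gamma_mulrV : right_inverse Gamma_one Gamma_inv Gamma_mul.
Proof.
case=> a s; rewrite /Gamma_mul /Gamma_inv /= subrr; congr (_, _).
by case: (Z2_cases s) => ->; rewrite /sign_act /= ?opprK ?subrr.
Qed.

End Gamma.

HB.instance Definition _ := Choice.on Gamma.
HB.instance Definition _ := isGroup.Build Gamma
  Gamma_mulA Gamma_mul1 Gamma_mulr1 Gamma_mulV Gamma_mulrV.

(* Main.v *)
Require Import Defs.
From HB Require Import structures.
From mathcomp Require Import boolp classical_sets cardinality fsbigop reals.
From mathcomp Require Import all_boot all_order all_algebra all_fingroup.
From mathcomp Require Import all_solvable finmap.
From mathcomp Require Import zify ring lra.

Set Implicit Arguments.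
Unset Strict Implicit.
Unset Printing Implicit Defensive.

Import Order.TTheory GRing.Theory Num.Theory.

(** Write elements of [Gamma] as [(v, s)] with [v] in the plane lattice. The
    finite quotients are the groups [(Z/n)^2 x| Z/2] with [n] a product of
    three distinct large odd primes: their order has seven prime factors, so
    their depth is at most 8 whatever the primes are.

    Let [D] be a Dress subgroup of such a quotient, with primes [p] and [q],
    and let [r] be a prime factor of [n] other than [p] and [q]. Every
    [r]-subgroup of [D] embeds into the cyclic layer of the normal series, so
    it is cyclic ([dress_pgroup_cyclic]); hence the translations in the
    preimage of [D] are, modulo [r], all multiples of one vector [(u, w)]
    ([cyclic_mod_prime]). By Thue's pigeonhole argument ([short_vector]) there
    is a nonzero vector [a], with coordinates at most [sqrt r], such that
    [dot a (u, w)] is divisible by [r]. The linear form [dot a] then maps those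
    translations to multiples of [r], although it stretches distances only by
    a factor of order [sqrt r].

    Through [dot a], the group [Gamma] acts on the integers by
    [(v, s) k = 2 dot a v + k] or [2 dot a v - k] ([line_act]). Joining [k] to
    [k + r] gives a graph [line_complex] whose components are lines, one for
    each class modulo [r], with virtually cyclic stabilisers. A component
    [c + r Z] preserved by the preimage of [D] always exists: [c = 0] if this
    preimage consists of translations, and [c = dot a v] if it contains
    [(v, 1)]. The map to the graph sends [g] to the point of that component at
    position [line_act a g 0]; its barycentric coordinates are given by a tent
    function of width [r] ([tent]). It is equivariant because [line_act g] is
    an isometry of the integers preserving the component ([tent_act]). A
    generator moves the position by at most a constant times [sqrt r], and the
    edges have length [r], so the [l1]-distances are at most a constant over
    [sqrt r] ([l1dist_tent]). *)

(** * Finite groups: subgroups of prime-power order and chains *)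

Section FiniteGroups.
Local Open Scope group_scope.

(** An [r]-subgroup of a Dress group dies in the [q]-group on top and meets the
    [p]-group at the bottom trivially. *)
Lemma dress_pgroup_cyclic (gT : finGroupType) (D : {group gT}) : dress D ->
  exists p q : nat, forall (r : nat) (M : {group gT}), r != p -> r != q ->
    r.-group M -> M \subset D -> cyclic M.
Proof.
case=> p [q [_ _ [P [H [nPH nHD [pP cHP qDH]]]]]].
exists p, q => r M rp rq rM sMD.
have coprime_r (s a b : nat) : r != s -> r.-nat a -> s.-nat b -> coprime a b.
  move=> rs ra sb; apply: (@pnat_coprime r) => //.
  by apply: pi_pnat sb _; rewrite !inE eq_sym.
have sMH : M \subset H.
  rewrite -quotient_sub1 ?(subset_trans sMD (normal_norm nHD)) //.
  rewrite -(setIidPl (quotientS H sMD)) coprime_TIg ?sub1G //.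
  exact: coprime_r rq (quotient_pgroup H rM) qDH.
have isoM : M \isog M / P.
  apply: quotient_isog; first exact: subset_trans sMH (normal_norm nPH).
  by rewrite setIC coprime_TIg //; exact: coprime_r rp rM pP.
by rewrite (isog_cyclic isoM) (cyclicS _ cHP) ?quotientS.
Qed.

(** The number of prime factors of [n], with multiplicity, for [0 < n < B].
    Summing over a range that does not depend on [n] makes it additive. *)
Definition prime_factors B n := \sum_(p < B) logn p n.

Lemma prime_factorsM B m n : 0 < m -> 0 < n ->
  prime_factors B (m * n) = prime_factors B m + prime_factors B n.
Proof.
by move=> m0 n0; rewrite -big_split; apply: eq_bigr => p _; apply: lognM.
Qed.

Lemma prime_factors_prime B p : prime p -> prime_factors B p <= 1.
Proof.
move=> pr_p; rewrite /prime_factors.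
under eq_bigr do rewrite logn_prime //.
have [ltpB|leBp] := ltnP p B.
  rewrite (bigD1 (Ordinal ltpB)) //= eqxx big1 // => i.
  by rewrite -val_eqE /= => /negbTE ->.
rewrite big1 // => i _; have := ltn_ord i.
by case: eqP => // -> ; rewrite ltnNge leBp.
Qed.

Lemma prime_factors_dvdn B d n : d %| n -> 0 < d < n -> n < B ->
  prime_factors B d < prime_factors B n.
Proof.
case/dvdnP=> k -> /andP[d0 dn] nB.
have k1 : 1 < k by rewrite -(ltn_pmul2r d0) mul1n.
rewrite prime_factorsM // ?(ltnW k1) // -[ltnLHS]add0n ltn_add2r.
have kB : pdiv k < B.
  apply: leq_ltn_trans nB; apply: leq_trans (pdiv_leq (ltnW k1)) _.
  by rewrite leq_pmulr.
rewrite /prime_factors (bigD1 (Ordinal kB)) //= addn_gt0.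
by rewrite logn_gt0 mem_primes pdiv_prime // pdiv_dvd (ltnW k1).
Qed.

(** By Lagrange, each step down a chain of subgroups loses a prime factor. *)
Lemma depth_prime_factors (gT : finGroupType) (F : {group gT}) :
  depth F <= (prime_factors #|F|.+1 #|F|).+1.
Proof.
have chain (c : seq {group gT}) (A : {group gT}) : A \subset F ->
    path (fun A B : {group gT} => B \proper A) A c ->
    size c <= prime_factors #|F|.+1 #|A|.
  elim: c A => //= C c IHc A sAF /andP[pCA /IHc le_c].
  apply: leq_ltn_trans (le_c (subset_trans (proper_sub pCA) sAF)) _.
  apply: prime_factors_dvdn; first exact: cardSg (proper_sub pCA).
    by rewrite cardG_gt0 proper_card.
  by rewrite ltnS subset_leq_card.
have [[|A c] sc <-//] := depth_attained F; rewrite /= ltnS.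
move: sc; rewrite /strict_chain /= => /andP[/andP[sAF _] pc].
apply: leq_trans (chain c A sAF pc) _.
by have [->//|ltAF] := eqVproper sAF; apply/ltnW/prime_factors_dvdn;
   rewrite ?cardSg ?cardG_gt0 ?proper_card.
Qed.

End FiniteGroups.

(** * Short vectors *)

(** Thue's pigeonhole argument: the map [(i, j) |-> i u + j w] modulo [r] is
    not injective on the square [[0, m]^2], which has more than [r] points. *)
Lemma short_vector (r m : nat) (u w : int) : (0 < r)%N -> (r < m.+1 ^ 2)%N ->
  exists a b : int, [/\ (a, b) != 0%R, (absz a <= m)%N, (absz b <= m)%N &
    (r%:Z %| (a * u + b * w)%R)%Z].
Proof.
move=> r0 rm; have r0Z : (r%:Z != 0)%R by lia.
pose F (x : 'I_m.+1 * 'I_m.+1) : int := (x.1%:Z * u + x.2%:Z * w)%R.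
have ltF x : (absz (F x %% r%:Z)%Z < r)%N.
  have := modz_ge0 (F x) r0Z; have := ltz_pmod (F x) (_ : 0 < r%:Z)%R.
  by lia.
pose f x : 'I_r := Ordinal (ltF x).
have /injectivePn[x [y neq_xy eq_f]] : ~~ injectiveb f.
  apply: contraL rm => /injectiveP/leq_card.
  by rewrite card_prod !card_ord -leqNgt mulnn.
exists (x.1%:Z - y.1%:Z)%R, (x.2%:Z - y.2%:Z)%R.
have [[[x1 x2] y1] y2] := (ltn_ord x.1, ltn_ord x.2, ltn_ord y.1, ltn_ord y.2).
split; try lia.
  apply: contraNneq neq_xy => -[] e1 e2; rewrite [x]surjective_pairing.
  rewrite [y]surjective_pairing.
  by apply/eqP; congr (_, _); apply: val_inj => /=; lia.
rewrite (_ : _ * u + _ * w = F x - F y)%R; last first.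
  by rewrite /F !mulrBl opprD addrACA.
rewrite -eqz_mod_dvd; apply/eqP.
have := congr1 val eq_f => /= eq_abs.
by rewrite -[LHS]gez0_abs ?modz_ge0 // eq_abs gez0_abs ?modz_ge0.
Qed.

(** * Virtually cyclic groups and stabilisers *)

Section Stabilisers.
Local Open Scope classical_set_scope.
Local Open Scope group_scope.

(** An invariant with finitely many values that separates the left cosets of
    [<c>] in [H] bounds their number. *)
Lemma finite_left_cosets (G : groupType) (T : finType) (H : set G) (c : G)
    (kappa : G -> T) : is_subgroup (cyclic_subgroup c) ->
  (forall x y, H x -> H y -> kappa x = kappa y ->
    cyclic_subgroup c (x^-1 * y)) ->
  finite_set (left_cosets (cyclic_subgroup c) H).
Proof.
set C := cyclic_subgroup c => -[C1 CM CV] kappaC.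
pose coset_at t :=
  [set z | exists2 y, H y /\ kappa y = t & exists2 k, C k & z = y * k].
apply: (@sub_finite_set _ _ (coset_at @` [set: T])); last first.
  exact: finite_image finite_finset.
move=> _ [x Hx <-]; exists (kappa x) => //; apply/seteqP; split=> z.
  case=> y [Hy eq_yx] [k Ck ->]; exists (x^-1 * y * k).
    by apply: CM => //; apply: kappaC.
  by rewrite !mulgA mulgV mul1g.
by case=> k Ck <-; exists x => //; exists k.
Qed.

Variables (R : realType) (G : groupType) (X : gcomplex G).

Lemma pact1 x : pact (R := R) (X := X) 1 x = x.
Proof. by apply/funext => v; rewrite /pact invg1 vact1. Qed.

Lemma pactM g h x : pact (R := R) (X := X) (g * h) x = pact g (pact h x).
Proof. by apply/funext => v; rewrite /pact invMg vactM. Qed.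

Lemma stabiliser_subgroup x : is_subgroup (@stabiliser R G X x).
Proof.
split; first exact: pact1.
  by move=> g h /= Eg Eh; rewrite /stabiliser /= pactM Eh Eg.
by move=> g /= Eg; rewrite /stabiliser /= -{1}Eg -pactM mulVg pact1.
Qed.

(** The stabiliser of a point permutes the vertices of its carrier, hence
    fixes them, because no simplex is stabilised without being fixed. *)
Lemma stabiliser_sub_vertex x : realisation R X x ->
  exists v, stabiliser x `<=` [set g | vact X g v = v].
Proof.
case=> _ [s [Xs xs0 xs1]].
pose t := [fset v in s | x v != 0%R]%fset.
have tP v : (v \in t) = (x v != 0%R).
  rewrite !inE; case: (boolP (v \in s)) => //= vNs.
  by rewrite xs0 // eqxx.
have [t0|[v tv]] := fset_0Vmem t.
  suff: (\sum_(v <- s) x v = 0)%R by rewrite xs1 => /eqP; rewrite oner_eq0.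
  by rewrite big1 // => v _; apply/eqP; rewrite -[_ == _]negbK -tP t0 inE.
have Xt : simplex X t.
  apply: simplex_face Xs _ _; first exact: fset_sub.
  by move=> t0; rewrite t0 inE in tv.
exists v => g /= gx; apply: vact_fix Xt _ _ tv.
have tg u : (vact X g u \in t) = (u \in t).
  by rewrite !tP -{1}gx /pact -vactM mulVg vact1.
apply/fsetP => u; apply/imfsetP/idP => [[w tw ->]|tu]; first by rewrite tg.
exists (vact X g^-1 u); last by rewrite -vactM mulgV vact1.
by rewrite /= -tg -vactM mulgV vact1.
Qed.

End Stabilisers.

(** * The action of [Gamma] on a line *)

Section Line.
Local Open Scope ring_scope.
Implicit Types (a v : int * int) (g h : Gamma) (k c z : int).

Definition dot a v : int := a.1 * v.1 + a.2 * v.2.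

Definition flip (s : 'Z_2) k : int := if s == 0 then k else - k.

(** The factor 2 makes the action preserve parity, so that it cannot flip an
    edge from [k] to [k + p] when [p] is odd. *)
Definition line_act a g k : int := 2%:Z * dot a g.1 + flip g.2 k.

Lemma Gamma_mulE g h :
  (g * h)%g = (g.1 + sign_act g.2 h.1, g.2 + h.2) :> Gamma.
Proof. by []. Qed.

Lemma Gamma_invE g : (g^-1)%g = (- sign_act g.2 g.1, - g.2) :> Gamma.
Proof. by []. Qed.

Lemma line_act1 a k : line_act a 1%g k = k.
Proof. by rewrite /line_act /dot /flip /= !mulr0 !add0r. Qed.

Lemma line_actM a g h k :
  line_act a (g * h)%g k = line_act a g (line_act a h k).
Proof.
case: g h => [[x y] s] [[x' y'] s']; rewrite Gamma_mulE /line_act /dot /=.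
by case: (Z2_cases s) (Z2_cases s') => -> [] ->;
   rewrite /flip /sign_act /=; ring.
Qed.

Lemma line_act_parity a g k : exists m : int, line_act a g k = k + 2%:Z * m.
Proof.
rewrite /line_act /flip; case: ifP => _; first by exists (dot a g.1); ring.
by exists (dot a g.1 - k); ring.
Qed.

Lemma line_actB a g k k' :
  line_act a g k - line_act a g k' = flip g.2 (k - k').
Proof. by rewrite /line_act /flip; case: ifP => _; ring. Qed.

Lemma flip_norm (s : 'Z_2) k : `|flip s k| = `|k|.
Proof. by rewrite /flip; case: ifP => // _; rewrite normrN. Qed.

Lemma dvdz_flip (s : 'Z_2) (p k : int) : (p %| flip s k)%Z = (p %| k)%Z.
Proof. by rewrite /flip; case: ifP => // _; rewrite !dvdzE abszN. Qed.

Section Complex.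
Variables (a : int * int) (p : nat).
Hypothesis p_odd : odd p.

Definition line_simplex (s : {fset int}) : Prop :=
  s <> fset0 /\ exists k : int, (s `<=` [fset k; (k + p%:Z)%R])%fset.

Let act := line_act a.

Fact line_simplex_neq0 s : line_simplex s -> s <> fset0.
Proof. by case. Qed.

Fact line_simplex_face s t :
  line_simplex s -> (t `<=` s)%fset -> t <> fset0 -> line_simplex t.
Proof.
by case=> _ [k sk] ts t0; split=> //; exists k; apply: fsubset_trans ts sk.
Qed.

Fact line_simplex_vertex k : line_simplex [fset k]%fset.
Proof.
split; first by move/fsetP/(_ k); rewrite !inE eqxx.
by exists k; apply/fsubsetP => u; rewrite !inE => ->.
Qed.

Fact line_simplex_act g s : line_simplex s -> line_simplex (act g @` s)%fset.
Proof.
case=> s0 [k /fsubsetP sk]; split.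
  have [//|[v vs]] := fset_0Vmem s.
  by move/fsetP/(_ (act g v)); rewrite inE in_imfset.
have := line_actB a g (k + p%:Z) k; rewrite /flip -/act.
case: ifP => _ e; [exists (act g k) | exists (act g (k + p%:Z))].
all: apply/fsubsetP => _ /imfsetP[v /= /sk + ->].
all: rewrite !inE => /orP[] /eqP ->; rewrite ?eqxx ?orbT //.
all: by apply/orP; right; apply/eqP; lia.
Qed.

(** The ends of an edge have different parities, so they are never swapped. *)
Fact line_act_fix g s : line_simplex s -> (act g @` s)%fset = s ->
  forall k, k \in s -> act g k = k.
Proof.
case=> s0 [k /fsubsetP sk] gs v vs.
have gvs : act g v \in s by rewrite -gs in_imfset.
have [m mE] := line_act_parity a g v; rewrite -/act in mE.
have pE := odd_double_half p; rewrite p_odd in pE.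
by move: (sk _ vs) (sk _ gvs); rewrite !inE => /orP[] /eqP ? /orP[] /eqP ?; lia.
Qed.

(** The components are the classes modulo [p], each a line subdivided with
    edges of length [p]; [Gamma] permutes them. *)
Definition line_complex : gcomplex Gamma :=
  GComplex line_simplex_neq0 line_simplex_face line_simplex_vertex
    (line_act1 a) (line_actM a) line_simplex_act line_act_fix.

Lemma line_complex_dim : dim_le line_complex 1.
Proof.
move=> s [_ [k sk]]; apply: leq_trans (fsubset_leq_card sk) _.
by rewrite cardfs2; case: eqP.
Qed.

End Complex.

Lemma Gamma_translation_expg v n : (((v, 0) : Gamma) ^+ n)%g = (v *+ n, 0).
Proof.
elim: n => [|n IHn]; first by rewrite expg0 mulr0n.
by rewrite expgS IHn Gamma_mulE /sign_act /= addr0 mulrS.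
Qed.

Lemma cyclic_translation v g : cyclic_subgroup ((v, 0) : Gamma) g <->
  exists m : int, g = ((m * v.1, m * v.2), 0).
Proof.
have mulE n : v *+ n = (n%:Z * v.1, n%:Z * v.2).
  case: v => x y; elim: n => [|n IHn]; first by rewrite mulr0n !mul0r.
  by rewrite mulrS IHn; congr (_, _) => /=; lia.
split=> [[n [->|->]]|[[n|n] ->]].
- by exists n; rewrite Gamma_translation_expg mulE.
- exists (- n%:Z); rewrite Gamma_translation_expg mulE Gamma_invE /sign_act /=.
  by rewrite !mulNr oppr0.
- by exists n; left; rewrite Gamma_translation_expg mulE.
exists n.+1; right; rewrite Gamma_translation_expg mulE Gamma_invE /sign_act /=.
by rewrite oppr0 NegzE !mulNr.
Qed.

Lemma cyclic_translation_subgroup v :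
  is_subgroup (cyclic_subgroup ((v, 0) : Gamma)).
Proof.
split; first by apply/cyclic_translation; exists 0; rewrite !mul0r.
  move=> x y /cyclic_translation[m ->] /cyclic_translation[n ->].
  apply/cyclic_translation; exists (m + n).
  by rewrite Gamma_mulE /sign_act /= addr0 !mulrDl.
move=> x /cyclic_translation[m ->]; apply/cyclic_translation; exists (- m).
by rewrite Gamma_invE /sign_act /= oppr0 !mulNr.
Qed.

(** The translations fixing a vertex lie in the kernel of [dot a], which
    contains [(a.2, - a.1)]. On that kernel, [dot (a.2, - a.1)] modulo
    [a.1 ^ 2 + a.2 ^ 2], its value at [(a.2, - a.1)], tells apart the cosets
    of this vector. *)
Lemma line_act_stab_vcyc a k : a != 0 ->
  vcyc_set ([set g | line_act a g k = k]%classic : set Gamma).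
Proof.
move=> a0; split.
  split; first exact: line_act1.
    by move=> g h /= gk hk; rewrite line_actM hk.
  by move=> g /= gk; rewrite -{1}gk -line_actM mulVg line_act1.
pose b := (a.2, - a.1); pose N := dot b b.
have N0 : 0 < N.
  case: (a) @b @N a0 => x y b N; rewrite /N /b /dot /= => a0.
  suff : x != 0 \/ y != 0 by nia.
  case: (eqVneq x 0) a0 => [->|]; last by left.
  by case: (eqVneq y 0) => [->|]; [rewrite eqxx | right].
exists ((b, 0) : Gamma); first by rewrite /line_act /dot /b /flip /=; ring.
pose kappa (g : Gamma) : 'I_(absz N).+1 * 'Z_2 :=
  (inord (absz (dot b g.1 %% N)%Z), g.2).
apply: (finite_left_cosets (kappa := kappa)).
  exact: cyclic_translation_subgroup.
move=> [v s] [v' s'] /= Hv Hv' [/(congr1 val) + ss']; subst s'.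
have ltN (u : int) : (absz (u %% N)%Z < (absz N).+1)%N.
  by have := ltz_pmod u N0; have := modz_ge0 u (lt0r_neq0 N0); lia.
rewrite /= !inordK // => eqN.
have {}eqN : (dot b v = dot b v' %[mod N])%Z.
  by rewrite -[LHS]gez0_abs ?modz_ge0 ?lt0r_neq0 // eqN gez0_abs ?modz_ge0
             ?lt0r_neq0.
move/esym/eqP: eqN; rewrite eqz_mod_dvd => /dvdzP[q qE].
have aE : dot a v' = dot a v by move: Hv Hv'; rewrite /line_act /=; lia.
have [e1 e2] : v'.1 - v.1 = q * b.1 /\ v'.2 - v.2 = q * b.2.
  move: qE aE N0; rewrite /N /b /dot /=.
  case: (a) (v) (v') => [x y] [u w] [u' w'] /=; set N' := (X in 0 < X).
  move=> qE aE /lt0r_neq0/mulfI N'I; split; apply: N'I.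
    transitivity (y * (q * N') + x * (x * (u' - u) + y * (w' - w))).
      by rewrite -qE /N'; ring.
    by rewrite (_ : x * _ + _ = 0); [ring | lia].
  transitivity (y * (x * (u' - u) + y * (w' - w)) - x * (q * N')).
    by rewrite -qE /N'; ring.
  by rewrite (_ : x * _ + _ = 0); [ring | lia].
apply/cyclic_translation; exists (flip s q).
rewrite Gamma_invE Gamma_mulE /= addNr; congr (_, _).
rewrite /flip /sign_act; case: (Z2_cases s) => -> /=.
  by rewrite addrC -e1 -e2.
by rewrite opprK !mulNr -e1 -e2 !opprB.
Qed.

(** * Tent functions *)

Section Tent.
Variables (R : realType) (a : int * int) (p : nat).
Hypothesis p_odd : odd p.

Let p_gt0 : (0 < p)%N := odd_gt0 p_odd.

(** The barycentric coordinates of the point at position [z] on the copy of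
    the line whose vertices are the integers congruent to [c] modulo [p]. *)
Definition tent c z k : R :=
  if (p%:Z %| (k - c)%R)%Z then Num.max 0 (1 - `|k - z|%:~R / p%:R) else 0.

Lemma tent_ge0 c z k : 0 <= tent c z k.
Proof. by rewrite /tent; case: ifP => // _; rewrite le_max lexx. Qed.

(** The carrier consists of the last vertex [k] up to [z] and of the next one;
    the two tents meeting between them add up to 1. *)
Lemma tent_carrier c z : exists k : int,
  (forall u, u \notin [fset k; (k + p%:Z)%R]%fset -> tent c z u = 0) /\
  tent c z k + tent c z (k + p%:Z) = 1.
Proof.
have pZ0 : p%:Z != 0 by lia.
have pR0 : 0 < p%:R :> R by rewrite ltr0n.
have zE := divz_eq (z - c) p; have m0 := modz_ge0 (z - c) pZ0.
have mp : ((z - c) %% p)%Z < p by rewrite ltz_pmod.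
move: ((z - c) %/ p)%Z ((z - c) %% p)%Z zE m0 mp => q m zE m0 mp.
exists (z - m); split=> [u|].
  rewrite !inE negb_or => /andP[u1 u2]; rewrite /tent; case: ifP => // dv.
  apply/max_idPl; rewrite subr_le0 ler_pdivlMr // mul1r [p%:R]pmulrn ler_int.
  case/dvdzP: dv => t tE; have : t != q /\ t != q + 1 by split; nia.
  by move=> [? ?]; nia.
rewrite /tent (_ : z - m - c = q * p) ?dvdz_mull //; last lia.
rewrite (_ : z - m + p - c = (q + 1) * p) ?dvdz_mull //; last lia.
have -> : `|z - m - z| = m by lia.
have -> : `|z - m + p - z| = p%:Z - m by lia.
rewrite rmorphB /= mulrBl -pmulrn divff ?gt_eqF // opprB addrCA subrr addr0.
have m1 : m%:~R / p%:R <= 1 :> R.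
  by rewrite ler_pdivrMr // mul1r [p%:R]pmulrn ler_int ltW.
have m2 : 0 <= m%:~R / p%:R :> R by rewrite divr_ge0 ?ler0z // ltW.
by rewrite !max_r ?subr_ge0 // subrK.
Qed.

Lemma tent_realisation c z : realisation R (line_complex a p_odd) (tent c z).
Proof.
split=> [k|]; first exact: tent_ge0.
have [k [supp sum1]] := tent_carrier c z.
exists [fset k; (k + p%:Z)%R]%fset; split=> //.
  split; last by exists k.
  by move/fsetP/(_ k); rewrite !inE eqxx.
rewrite big_fsetU1 /= ?big_seq_fset1 // inE.
by apply/eqP; lia.
Qed.

(** Elements preserving the component of [c] act on it by isometries. *)
Lemma tent_act c z g : (p%:Z %| (line_act a g c - c)%R)%Z ->
  tent c (line_act a g z) = pact (X := line_complex a p_odd) g (tent c z).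
Proof.
move=> dvc; apply/funext => k; rewrite /pact /=.
have kE : k = line_act a g (line_act a g^-1%g k).
  by rewrite -line_actM mulgV line_act1.
move: (line_act a g^-1%g k) kE => u ->; rewrite /tent line_actB flip_norm.
rewrite (_ : _ - c = flip g.2 (u - c) + (line_act a g c - c)); last first.
  by rewrite -(line_actB a); ring.
by rewrite rpredDr // -[in RHS](dvdz_flip g.2).
Qed.

Lemma tent_lipschitz c z z' k :
  `|tent c z k - tent c z' k| <= `|z - z'|%:~R / p%:R.
Proof.
have pR0 : 0 < p%:R :> R by rewrite ltr0n.
rewrite /tent; case: ifP => _; last first.
  by rewrite subrr normr0 divr_ge0 ?ler0n // ler0z.
have le_abs (u v : int) : `|u| <= `|v| + `|u - v|.
  by rewrite addrC; apply: le_trans (ler_normD _ _); rewrite subrK.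
have step (u v : int) :
    `|u|%:~R / p%:R <= `|v|%:~R / p%:R + `|u - v|%:~R / p%:R :> R.
  by rewrite -mulrDl ler_pM2r ?invr_gt0 // -intrD ler_int.
have s1 := step (k - z) (k - z'); have s2 := step (k - z') (k - z).
have e1 : `|k - z - (k - z')| = `|z - z'| by lia.
have e2 : `|k - z' - (k - z)| = `|z - z'| by lia.
move: s1 s2; rewrite e1 e2.
set A := _ / p%:R; set B := _ / p%:R; set C := _ / p%:R => s1 s2.
by rewrite ler_norml; case: (lerP 0 (1 - A)); case: (lerP 0 (1 - B)); lra.
Qed.

(** Both points have at most two nonzero coordinates. *)
Lemma l1dist_tent c z z' :
  l1dist (X := line_complex a p_odd) (tent c z) (tent c z')
    <= 4%:R * `|z - z'|%:~R / p%:R.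
Proof.
have [k [supp _]] := tent_carrier c z; have [k' [supp' _]] := tent_carrier c z'.
pose A := ([fset k; (k + p%:Z)%R] `|` [fset k'; (k' + p%:Z)%R])%fset.
rewrite /l1dist (@fsbigTE _ _ _ _ A) => [|u]; last first.
  rewrite in_fsetU negb_or => /andP[/supp -> /supp' ->].
  by rewrite subrr normr0.
apply: le_trans (ler_sum _ (fun u _ => tent_lipschitz c z z' u)) _.
rewrite big_const_seq count_predT iter_addr_0 -mulrA -[leLHS]mulr_natl.
apply: ler_wpM2r; first by rewrite divr_ge0 ?ler0n ?ler0z.
rewrite ler_nat /= (leq_trans (leq_card_fsetU _ _).1) // !cardfs2.
by do 2!case: (_ != _).
Qed.

End Tent.

Lemma line_complex_stabiliser (R : realType) a p (p_odd : odd p) x : a != 0 ->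
  realisation R (line_complex a p_odd) x ->
  Defs.family_mem (vcyc Gamma) (stabiliser x).
Proof.
move=> a0 /stabiliser_sub_vertex[k sub_k].
exact: vcyc_sub (line_act_stab_vcyc k a0) (stabiliser_subgroup x) sub_k.
Qed.

End Line.

(** * Finite dihedral quotients *)

Section Dihedral.
Local Open Scope group_scope.
Local Open Scope ring_scope.

Definition dihedral (n : nat) : Type := (('Z_n * 'Z_n) * 'Z_2)%type.

Section Laws.
Variable n : nat.
Implicit Types (x y : dihedral n) (v : 'Z_n * 'Z_n).

Definition dih_sign (s : 'Z_2) v := if s == 0 then v else - v.

Definition dih_one : dihedral n := (0, 0).
Definition dih_mul x y : dihedral n := (x.1 + dih_sign x.2 y.1, x.2 + y.2).
Definition dih_inv x : dihedral n := (- dih_sign x.2 x.1, - x.2).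

Fact dih_mulA : associative dih_mul.
Proof.
move=> [v s] [v' s'] [v'' s'']; rewrite /dih_mul /dih_sign /= !addrA.
by case: (Z2_cases s) (Z2_cases s') => -> [] -> /=;
   rewrite ?opprD ?opprK ?addrA.
Qed.

Fact dih_mul1 : left_id dih_one dih_mul.
Proof. by case=> v s; rewrite /dih_mul /= !add0r. Qed.

Fact dih_mulV : left_inverse dih_one dih_inv dih_mul.
Proof.
case=> v s; rewrite /dih_mul /dih_inv /= addNr; congr (_, _).
by case: (Z2_cases s) => ->; rewrite /dih_sign /= addNr.
Qed.

End Laws.

HB.instance Definition _ n := Finite.on (dihedral n).
HB.instance Definition _ n := Finite_isGroup.Build (dihedral n)
  (@dih_mulA n) (@dih_mul1 n) (@dih_mulV n).

Definition reduction n (g : Gamma) : dihedral n :=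
  ((g.1.1%:~R, g.1.2%:~R), g.2).

Fact reductionM n : {morph @reduction n : g h / (g * h)%g}.
Proof.
move=> [[x y] s] [[x' y'] s']; rewrite Gamma_mulE.
rewrite [RHS]/(dih_mul _ _) /reduction /dih_mul /sign_act /dih_sign /=.
by case: (Z2_cases s) => -> /=; rewrite ?rmorphB ?rmorphD.
Qed.

HB.instance Definition _ n :=
  isMultiplicative.Build Gamma (dihedral n) (@reduction n) (@reductionM n).

Lemma reduction_surj n q : exists g, reduction n g = q.
Proof.
case: q => [[x y] s]; exists (((x : nat)%:Z, (y : nat)%:Z), s).
by rewrite /reduction /= -!pmulrn !natr_Zp.
Qed.

Lemma dih_translation_expg n (v : 'Z_n * 'Z_n) k :
  (((v, 0) : dihedral n) ^+ k)%g = (v *+ k, 0).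
Proof.
elim: k => [|k IHk]; first by rewrite expg0 mulr0n.
by rewrite expgS IHk [LHS]/(dih_mul _ _) /dih_mul /dih_sign /= addr0 mulrS.
Qed.

Lemma pair_mulrn (U V : zmodType) (x : U * V) k : x *+ k = (x.1 *+ k, x.2 *+ k).
Proof. by elim: k => // k IHk; rewrite !mulrS IHk. Qed.

Lemma intr_Zp_eq0 n (z : int) : (1 < n)%N ->
  (z%:~R == 0 :> 'Z_n) = (n%:Z %| z)%Z.
Proof.
move=> n1; have natE k : (k%:R == 0 :> 'Z_n) = (n %| k)%N.
  by rewrite -val_eqE /= val_Zp_nat.
rewrite dvdzE /= -natE; case: z => k /=; first by rewrite -pmulrn.
by rewrite NegzE mulrNz oppr_eq0 -pmulrn.
Qed.

(** Multiplication by [m] identifies translations modulo [r] with the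
    [r]-torsion translations modulo [r * m]; those lying in [D] form an
    [r]-group, whose generator yields [(u, w)]. *)
Lemma cyclic_mod_prime (r m : nat) (D : {group dihedral (r * m)}) :
  prime r -> (0 < m)%N ->
  (forall M : {group dihedral (r * m)},
    r.-group M -> M \subset D -> cyclic M) ->
  exists u w : int, forall v : int * int, reduction (r * m) (v, 0) \in D ->
    exists t : int, (r%:Z %| v.1 - t * u)%Z /\ (r%:Z %| v.2 - t * w)%Z.
Proof.
move=> pr_r m0; set n := (r * m)%N in D * => cycD.
have n1 : (1 < n)%N by rewrite /n; have := prime_gt1 pr_r; nia.
pose M := [set x in D | (x.2 == 0) && (x.1 *+ r == 0)].
have gM : group_set M.
  apply/group_setP; split; first by rewrite inE group1 /= mul0rn !eqxx.
  move=> [v s] [v' s']; rewrite !inE /=.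
  case/and3P=> Dx /eqP s0 /eqP rx /and3P[Dy /eqP s0' /eqP ry].
  subst s s'.
  rewrite groupM //= /dih_sign /=.
  by rewrite mulrnDl rx ry addr0.
have rM : r.-group (Group gM).
  rewrite -pnat_exponent; apply: (@pnat_dvd _ r); last by rewrite pnat_id.
  apply/exponentP => -[v s]; rewrite inE /= => /and3P[_ /eqP-> /eqP rv].
  by rewrite dih_translation_expg rv.
have sMD : Group gM \subset D by apply/subsetP => x; rewrite inE => /andP[].
have /cyclicP[[c s] /= Mc] := cycD _ rM sMD.
have : ((c, s) : dihedral n) \in M by rewrite Mc cycle_id.
rewrite inE /= => /and3P[_ /eqP s0 /eqP rc]; move: Mc; rewrite {}s0 => Mc.
have valE (x : 'Z_n) : x *+ r = 0 -> exists u : nat, (x : nat) = (m * u)%N.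
  rewrite -{1}[x]natr_Zp -mulrnA pmulrn => /eqP; rewrite intr_Zp_eq0 //.
  rewrite dvdzE /= => nx; exists (x %/ m)%N; rewrite mulnC divnK //.
  by rewrite -(dvdn_pmul2l (prime_gt0 pr_r)) -/n mulnC.
move: rc; rewrite pair_mulrn => -[/valE[u uE] /valE[w wE]]; exists u, w => v Dv.
have : (reduction n (v, 0) ^+ m)%g \in M.
  rewrite inE groupX // dih_translation_expg /= -mulrnA mulnC -/n.
  by rewrite pair_mulrn; apply/eqP; congr (_, _); apply/eqP;
     rewrite /= -mulr_natr [n%:R]pmulrn -intrM intr_Zp_eq0 //;
     apply: dvdz_mull.
rewrite Mc => /cycleP[t]; rewrite !dih_translation_expg !pair_mulrn => -[e1 e2].
have coord (z : int) (x : 'Z_n) (k : nat) : (x : nat) = (m * k)%N ->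
    z%:~R *+ m = x *+ t -> (r%:Z %| z - t%:Z * k%:Z)%Z.
  move=> xE /eqP; rewrite -[x]natr_Zp xE -[_ *+ t]mulrnA -subr_eq0.
  rewrite -mulr_natr [m%:R]pmulrn [(_ * t)%:R]pmulrn.
  rewrite -intrM -rmorphB intr_Zp_eq0 //=.
  rewrite (_ : _ - _ = (z - t%:Z * k%:Z) * m); last lia.
  case/dvdzP=> q; rewrite /n PoszM mulrA => qE; apply/dvdzP; exists q.
  by apply: (mulIf (_ : m%:Z != 0)) qE; lia.
by exists t; split; [apply: coord e1 | apply: coord e2].
Qed.

Lemma depth_dihedral (p1 p2 p3 : nat) : prime p1 -> prime p2 -> prime p3 ->
  (depth [set: dihedral (p1 * (p2 * p3))]%G <= 8)%N.
Proof.
move=> pr1 pr2 pr3; apply: leq_trans (depth_prime_factors _) _.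
have [g1 g2 g3] := And3 (prime_gt0 pr1) (prime_gt0 pr2) (prime_gt0 pr3).
have n1 : (1 < p1 * (p2 * p3))%N.
  by apply: leq_trans (prime_gt1 pr1) _; rewrite leq_pmulr // muln_gt0 g2.
rewrite /= cardsT /dihedral !card_prod !card_ord !Zp_cast // ltnS.
rewrite !prime_factorsM ?muln_gt0 ?g1 ?g2 ?g3 //.
set B := (_ * 2).+1.
have := prime_factors_prime B pr1; have := prime_factors_prime B pr2.
have := prime_factors_prime B pr3; have := @prime_factors_prime B 2 isT.
lia.
Qed.

End Dihedral.

(** * The theorem *)

Lemma sqrt_floor r : exists m, (m ^ 2 <= r < m.+1 ^ 2)%N.
Proof.
elim: r => [|r [m /andP[m1 m2]]]; first by exists 0%N.
have [ltr|ger] := ltnP r.+1 (m.+1 ^ 2); first by exists m; lia.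
by exists m.+1; nia.
Qed.

Lemma three_primes k : exists p1 p2 p3, [/\ [/\ prime p1, prime p2 & prime p3],
  (k < p1)%N, (p1 < p2)%N & (p2 < p3)%N].
Proof.
have [p1 lt1 pr1] := prime_above k; have [p2 lt2 pr2] := prime_above p1.
by have [p3 lt3 pr3] := prime_above p2; exists p1, p2, p3.
Qed.

Local Open Scope ring_scope.

(** At each of three primes the translations in [D] might fill the plane, but
    a Dress group can only do this at the two primes of its definition. *)
Lemma dress_cyclic_mod_prime (p1 p2 p3 : nat)
    (D : {group dihedral (p1 * (p2 * p3))}) :
  prime p1 -> prime p2 -> prime p3 -> (p1 < p2)%N -> (p2 < p3)%N -> dress D ->
  exists r (u w : int), [/\ prime r, (p1 <= r)%N &
    forall v : int * int, reduction _ (v, 0) \in D ->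
      exists t : int, (r%:Z %| v.1 - t * u)%Z /\ (r%:Z %| v.2 - t * w)%Z].
Proof.
move=> pr1 pr2 pr3 lt12 lt23 /dress_pgroup_cyclic[p [q cycD]].
have [g1 g2 g3] := And3 (prime_gt0 pr1) (prime_gt0 pr2) (prime_gt0 pr3).
have [r [m [pr_r le_r m0 nE [rp rq]]]] : exists r m,
    [/\ prime r, (p1 <= r)%N, (0 < m)%N, (p1 * (p2 * p3) = r * m)%N
      & r != p /\ r != q].
  have [/andP[]|bad1] := boolP ((p1 != p) && (p1 != q)).
    by exists p1, (p2 * p3)%N; split=> //; rewrite muln_gt0 g2.
  have [/andP[]|bad2] := boolP ((p2 != p) && (p2 != q)).
    by exists p2, (p1 * p3)%N; split=> //; rewrite ?muln_gt0 ?g1 //; lia.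
  exists p3, (p1 * p2)%N; rewrite muln_gt0 g1 g2 pr3; split=> //; lia.
have {}cycD M := cycD r M rp rq.
move: D cycD; rewrite nE => D cycD.
by have [u [w uw]] := cyclic_mod_prime pr_r m0 cycD; exists r, u, w.
Qed.

Lemma translation_bound (S : {fset Gamma}) : exists C : nat,
  forall s, s \in S -> (absz s.1.1 <= C)%N /\ (absz s.1.2 <= C)%N.
Proof.
exists (\max_(s <- S) maxn (absz s.1.1) (absz s.1.2))%N => s sS.
pose F (g : Gamma) := maxn (absz g.1.1) (absz g.1.2).
have := @leq_bigmax_seq _ (enum_fset S) xpredT F s sS isT.
by rewrite geq_max => /andP[].
Qed.

(** The components of the graph are the classes modulo [r]. When the preimage
    of [D] contains a reflection, the component must pass through its fixed
    point, and translations by multiples of [r] make the choice of the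
    reflection immaterial. *)
Lemma invariant_component n r a (D : {group dihedral n}) :
  (forall v, reduction n (v, 0) \in D -> (r%:Z %| dot a v)%Z) ->
  exists c : int, forall h, reduction n h \in D ->
    (r%:Z %| line_act a h c - c)%Z.
Proof.
move=> dvd_dot.
have dvd_translation v c : reduction n (v, 0) \in D ->
    (r%:Z %| (line_act a (v, 0) c - c)%R)%Z.
  by move=> Dv; rewrite /line_act /flip /= addrK dvdz_mull // dvd_dot.
have [[w Dw]|noD] := pselect (exists w, reduction n (w, 1) \in D); last first.
  exists 0 => -[v s] Dh; case: (Z2_cases s) Dh => ->.
    exact: dvd_translation.
  by move=> Dv; case: noD; exists v.
exists (dot a w) => -[v s] Dh; case: (Z2_cases s) Dh => -> Dv.
  exact: dvd_translation.
have -> : line_act a (v, 1) (dot a w) - dot a w = 2%:Z * dot a (v - w).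
  by rewrite /line_act /flip /dot /=; ring.
apply/dvdz_mull/dvd_dot.
suff -> : ((v - w, 0) : Gamma) = (((v, 1%R) : Gamma) * ((w, 1%R) : Gamma))%g.
  by rewrite reductionM; apply: groupM Dv Dw.
by rewrite Gamma_mulE /sign_act /=; congr (_, _); apply: val_inj.
Qed.

Lemma line_act_displacement a g g' :
  `|line_act a g 0 - line_act a g' 0| = 2%:Z * `|dot a (g^-1 * g')%g.1|.
Proof.
have -> : g' = (g * (g^-1 * g'))%g by rewrite mulgA mulgV mul1g.
rewrite line_actM line_actB flip_norm mulKg.
by rewrite /line_act /flip oppr0 if_same addr0 sub0r normrN normrM.
Qed.

Theorem lemma5p2 (R : realType) (S : {fset Gamma}) (hS : is_sym_gen_set S) :
  DFH_bounded_depth R S (vcyc Gamma).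
Proof.
have [C boundC] := translation_bound S.
exists 1%N, 8%N => eps eps0.
(* With [m] the integer part of [sqrt r], the distances are bounded by
   [16 * m * C / r <= 16 * C / m], and [K <= m] makes this at most [eps]. *)
pose K := Num.bound (16%:R * C%:R / eps).
have leK : 16%:R * C%:R <= eps * K%:R.
  rewrite [leRHS]mulrC -ler_pdivrMr // ltW // archi_boundP //.
  by rewrite divr_ge0 ?mulr_ge0 ?ler0n // ltW.
have [p1 [p2 [p3 [[pr1 pr2 pr3] lt1 lt12 lt23]]]] := three_primes (K ^ 2 + 2).
exists (dihedral (p1 * (p2 * p3))), (@reduction (p1 * (p2 * p3))).
split; first exact: reduction_surj.
  exact: depth_dihedral.
move=> D /(dress_cyclic_mod_prime pr1 pr2 pr3 lt12 lt23).
case=> r [u [w [pr_r le_r uw]]].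
have r_odd : odd r by case: (even_prime pr_r) => // r2; lia.
have [m /andP[m_le lt_m]] := sqrt_floor r.
have [b1 [b2 [b0 b1m b2m dvd_b]]] := short_vector u w (prime_gt0 pr_r) lt_m.
pose a := (b1, b2).
have dvd_dot v : reduction _ (v, 0) \in D -> (r%:Z %| dot a v)%Z.
  case/uw=> t [d1 d2].
  rewrite (_ : dot a v = b1 * (v.1 - t * u) + b2 * (v.2 - t * w) +
                         t * (b1 * u + b2 * w)); last by rewrite /dot /=; ring.
  by rewrite !rpredD // dvdz_mull.
exists (line_complex a r_odd); split.
- exact: line_complex_dim.
- by move=> x; apply: line_complex_stabiliser.
have [c cP] := invariant_component dvd_dot.
exists (fun g => tent R r c (line_act a g 0)); split.
- by move=> g; apply: tent_realisation.
- by move=> h g Dh; rewrite line_actM; apply: tent_act (cP _ Dh).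
move=> g g' /boundC[C1 C2].
have := l1dist_tent R a r_odd c (line_act a g 0) (line_act a g' 0).
move=> /le_trans; apply.
have leKm : K%:R <= m%:R :> R by rewrite ler_nat; nia.
have z_le : `|line_act a g 0 - line_act a g' 0| <= (4 * m * C)%N%:Z.
  rewrite line_act_displacement.
  move: (g^-1 * g')%g.1 C1 C2 => [x y] /= C1 C2; rewrite /dot /=.
  have bnd_x : (absz (b1 * x)%R <= m * C)%N by rewrite abszM leq_mul.
  have bnd_y : (absz (b2 * y)%R <= m * C)%N by rewrite abszM leq_mul.
  by lia.
rewrite ler_pdivrMr ?ltr0n ?prime_gt0 //.
apply: (@le_trans _ _ (16%:R * C%:R * m%:R)).
  have : `|line_act a g 0 - line_act a g' 0|%:~R <= (4 * m * C)%N%:R :> R.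
    by rewrite [leRHS]pmulrn ler_int.
  by rewrite !natrM; lra.
apply: (@le_trans _ _ (eps * m%:R * m%:R)).
  rewrite ler_wpM2r //; apply: le_trans leK _.
  by rewrite ler_wpM2l // ltW.
by rewrite -mulrA -natrM ler_pM2l // ler_nat mulnn.
Qed.
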